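(* Under the ordering whose set $P$ of positive elements comprises all $[f]\in\mathbb{E}$ for which $f(m)$ takes on infinitely many positive values as $m$ ranges over $\mathbb{N}$, the field $\mathbb{E}=S/B$ of Eudoxus reals (with multiplication $[f][g]=[f\circ g]$) is an ordered field.
   Context: A function $f:\mathbb{Z}\to\mathbb{Z}$ is an almost homomorphism iff the function $d_f(p,q)=f(p+q)-f(p)-f(q)$ from $\mathbb{Z}\times\mathbb{Z}$ to $\mathbb{Z}$ has bounded range, i.e. for some integer $C$, $|d_f(p,q)|<C$ for all $p,q\in\mathbb{Z}$. $S$ is the abelian group of all almost homomorphisms $\mathbb{Z}\to\mathbb{Z}$ under pointwise addition, and $B$ is the subgroup of all functions $\mathbb{Z}\to\mathbb{Z}$ with bounded range. The abelian group of Eudoxus reals is the quotient $\mathbb{E}=S/B$; $[f]$ denotes the class of $f\in S$. $\mathbb{E}$ is a field under the multiplication $[f][g]=[f\circ g]$, with unit $[p\mapsto p]$. Here $\mathbb{N}$ denotes the non-negative integers, and membership of $P$ does not depend on the choice of representative. An ordered abelian group is an abelian group $G$ together with a set $P\subseteq G$ of positive elements such that: (1) $0\notin P$; (2) if $x\in P$ and $y\in P$ then $x+y\in P$; (3) if $x$ is any non-zero element of $G$ then either $x$ or $-x$ is a member of $P$. An ordered field is a field $F$ together with a set $P\subseteq F$ of positive elements which makes the additive group of $F$ an ordered abelian group and satisfies: (1) the unit element $1$ is in $P$; (2) if $x\in P$ and $y\in P$, then $xy\in P$. *)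

(* Defs.v *)
From HB Require Import structures.
From mathcomp Require Import all_boot all_order all_algebra.
From mathcomp Require Import boolp classical_sets functions cardinality.
From mathcomp Require Import zify.

Set Implicit Arguments.
Unset Strict Implicit.
Unset Printing Implicit Defensive.

Import Order.TTheory GRing.Theory Num.Theory.
Local Open Scope classical_set_scope.
Local Open Scope ring_scope.

(* P is the set of positive elements.  The cases of the last clause need not
   be assumed exclusive: the first two clauses imply that they are. *)
Definition is_ordered_abelian_group (G : zmodType) (P : set G) : Prop :=
  [/\ ~ P 0,
      forall x y, P x -> P y -> P (x + y)
    & forall x, x <> 0 -> P x \/ P (- x)].

Definition is_ordered_field (F : fieldType) (P : set F) : Prop :=
  [/\ is_ordered_abelian_group P,
      P 1
    & forall x y, P x -> P y -> P (x * y)].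

Definition hom_defect (f : int -> int) (p q : int) : int :=
  f (p + q) - f p - f q.

Definition is_almost_hom (f : int -> int) : Prop :=
  exists C : int, forall p q, `|hom_defect f p q| < C.

Definition has_bounded_range (f : int -> int) : Prop :=
  exists C : int, forall p, `|f p| < C.

Lemma almost_hom_opp (f : int -> int) :
  is_almost_hom f -> is_almost_hom (- f).
Proof.
move=> [C hC]; exists C => p q.
by have := hC p q; rewrite /hom_defect !fctE; lia.
Qed.

Lemma almost_hom_add (f g : int -> int) :
  is_almost_hom f -> is_almost_hom g -> is_almost_hom (f + g).
Proof.
move=> [C hC] [D hD]; exists (C + D) => p q.
by have := hC p q; have := hD p q; rewrite /hom_defect !fctE; lia.
Qed.

Lemma almost_hom_bounded f : has_bounded_range f -> is_almost_hom f.
Proof.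
move=> [C hC]; exists (C * 3) => p q.
by have := hC (p + q); have := hC p; have := hC q; rewrite /hom_defect; lia.
Qed.

Lemma almost_hom_mul_nat f (C : int) (hC : forall p q, `|hom_defect f p q| < C)
    (n : nat) (q : int) : `|f (n%:Z * q) - n%:Z * f q| <= (n%:Z + 1) * C.
Proof.
rewrite /hom_defect in hC.
elim: n => [|n IHn].
  move: (hC 0 0); rewrite addr0 !mul0r subr0 add0r mul1r.
  by set x := f 0; lia.
have := hC (n%:Z * q) q; rewrite (_ : n%:Z * q + q = n.+1%:Z * q); last by lia.
by lia.
Qed.

Lemma almost_hom_mul f (C : int) (hC : forall p q, `|hom_defect f p q| < C)
    (p q : int) : `|f (p * q) - p * f q| <= (`|p| + 3) * C.
Proof.
have [p0|p0] := leP 0 p.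
  have := almost_hom_mul_nat hC `|p|%N q; rewrite (_ : `|p|%N%:Z = p); last lia.
  by rewrite (ger0_norm p0); have := hC 0 0; lia.
have := almost_hom_mul_nat hC `|p|%N q; rewrite (_ : `|p|%N%:Z = - p); last lia.
rewrite (ltr0_norm p0); move: (hC (p * q) (- p * q)) (hC 0 0).
rewrite /hom_defect.
rewrite (_ : p * q + - p * q = 0) ?addr0; last lia.
by set u := f (- p * q); set v := f (p * q); set w := f 0; lia.
Qed.

Lemma almost_hom_growth f : is_almost_hom f ->
  exists A : int, 0 <= A /\ forall p, `|f p| <= A * (`|p| + 3).
Proof.
move=> [C hC]; exists (C + `|f 1|); split; first by have := hC 0 0; lia.
move=> p; have := almost_hom_mul hC p 1; rewrite mulr1.
have : `|p * f 1| = `|p| * `|f 1| by rewrite normrM.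
lia.
Qed.

Lemma almost_hom_image f (K : int) : is_almost_hom f ->
  exists D : int, forall e, `|e| <= K -> `|f e| <= D.
Proof.
move=> /almost_hom_growth[A [A0 hA]]; exists (A * (K + 3)) => e eK.
by apply: le_trans (hA e) _; rewrite ler_wpM2l // lerD2r.
Qed.

Lemma almost_hom_comp f g :
  is_almost_hom f -> is_almost_hom g -> is_almost_hom (f \o g).
Proof.
move=> hf [D hD]; have [L hE] := almost_hom_image D hf; have [C hC] := hf.
exists (C * 2 + L + 1) => p q; rewrite /hom_defect /=.
set e := hom_defect g p q; have := hE e (ltW (hD p q)).
have := hC (g p) (g q); have := hC (g p + g q) e; rewrite /hom_defect.
by rewrite (_ : g p + g q + e = g (p + q)); [lia | rewrite /e /hom_defect; lia].
Qed.

Lemma almost_hom_id : is_almost_hom id.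
Proof. by exists 1 => p q; rewrite /hom_defect; lia. Qed.

Lemma comp_bounded_l (f f' g : int -> int) :
  has_bounded_range (f - f') -> has_bounded_range ((f \o g) - (f' \o g)).
Proof. by move=> [C hC]; exists C => p; apply: (hC (g p)). Qed.

Lemma comp_bounded_r (f g g' : int -> int) : is_almost_hom f ->
  has_bounded_range (g - g') -> has_bounded_range ((f \o g) - (f \o g')).
Proof.
move=> hf [D hD]; have [L hE] := almost_hom_image D hf; have [C hC] := hf.
exists (C + L + 1) => p; have hDp := hD p; rewrite !fctE /= in hDp *.
have := hE (g p - g' p) (ltW hDp); have := hC (g' p) (g p - g' p).
by rewrite /hom_defect (_ : g' p + (g p - g' p) = g p); lia.
Qed.

Lemma comp_commute (f g : int -> int) : is_almost_hom f -> is_almost_hom g ->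
  has_bounded_range ((f \o g) - (g \o f)).
Proof.
move=> hf hg; have [A [A0 hA]] := almost_hom_growth hf.
have [B [B0 hB]] := almost_hom_growth hg.
have [C hC] := hf; have [D hD] := hg.
have C0 : 0 <= C by have := hC 0 0; lia.
have D0 : 0 <= D by have := hD 0 0; lia.
pose K := C * (4 + B * 4 + 3) + D * (4 + A * 4 + 3).
have K0 : 0 <= K by rewrite addr_ge0 // mulr_ge0 //; lia.
have bnd (p : int) : p != 0 -> `|f (g p) - g (f p)| <= K.
  move=> p0; pose n := `|p|; have n1 : 1 <= n by rewrite /n; lia.
  have h1 := almost_hom_mul hC p (g p); have h2 := almost_hom_mul hC (g p) p.
  have h3 := almost_hom_mul hD p (f p); have h4 := almost_hom_mul hD (f p) p.
  have gl : `|g p| + 3 <= n * (B * 4 + 3).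
    by have := hB p; rewrite -/n; nia.
  have fl : `|f p| + 3 <= n * (A * 4 + 3).
    by have := hA p; rewrite -/n; nia.
  have pl : `|p| + 3 <= n * 4 by rewrite -/n; lia.
  have k1 : (`|p| + 3) * C <= n * 4 * C by rewrite ler_wpM2r.
  have k2 : (`|g p| + 3) * C <= n * (B * 4 + 3) * C by rewrite ler_wpM2r.
  have k3 : (`|p| + 3) * D <= n * 4 * D by rewrite ler_wpM2r.
  have k4 : (`|f p| + 3) * D <= n * (A * 4 + 3) * D by rewrite ler_wpM2r.
  have : `|p * (f (g p) - g (f p))| <= n * K.
    have e1 : p * g p = g p * p by rewrite mulrC.
    have e2 : p * f p = f p * p by rewrite mulrC.
    have e3 : g p * f p = f p * g p by rewrite mulrC.
    rewrite e1 in h1; rewrite e2 in h3; rewrite e3 in h2.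
    have -> : n * K = n * 4 * C + n * (B * 4 + 3) * C +
              n * 4 * D + n * (A * 4 + 3) * D by rewrite /K; lia.
    by rewrite mulrBr; lia.
  by rewrite normrM -/n ler_pM2l //; lia.
exists (K + `|f (g 0) - g (f 0)| + 1) => p; rewrite !fctE /=.
by have [->|/bnd] := eqVneq p 0; lia.
Qed.

Lemma unbounded_exists f : ~ has_bounded_range f ->
  forall K : int, exists p, K <= `|f p|.
Proof.
move=> nf K; apply: contrapT => nex; apply: nf; exists K => p.
by rewrite ltNge; apply/negP => Kp; apply: nex; exists p.
Qed.

Lemma almost_hom_proper f (K : int) :
  is_almost_hom f -> ~ has_bounded_range f ->
  exists L : int, forall p, `|f p| <= K -> `|p| <= L.
Proof.
move=> [C hC] /unbounded_exists /(_ (C + 1))[m hm].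
have C0 : 0 <= C by have := hC 0 0; lia.
exists (`|m| * K + (`|m| + 6) * C) => p pK.
have h1 := almost_hom_mul hC p m; have h2 := almost_hom_mul hC m p.
rewrite (mulrC m p) in h2.
have h3 : `|p * f m| = `|p| * `|f m| by rewrite normrM.
have h4 : `|m * f p| <= `|m| * K by rewrite normrM ler_wpM2l.
have h5 : `|p| * (C + 1) <= `|p| * `|f m| by rewrite ler_wpM2l.
move: h1 h2 h3 h4 h5; move: (f (p * m)) (p * f m) (m * f p) (`|p| * `|f m|).
by move=> a b c d; lia.
Qed.

Lemma almost_hom_at0 f (C : int) :
  (forall p q, `|hom_defect f p q| < C) -> `|f 0| < C.
Proof.
by move=> /(_ 0 0); rewrite /hom_defect addr0; move: (f 0) => x; lia.
Qed.

Lemma almost_hom_atN f (C : int) (m : int) :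
  (forall p q, `|hom_defect f p q| < C) -> `|f m + f (- m)| < C * 2.
Proof.
move=> hC; have := hC m (- m); have := almost_hom_at0 hC.
rewrite /hom_defect (subrr m).
by move: (f 0) (f m) (f (- m)) => x y z; lia.
Qed.

Lemma almost_hom_almost_onto f : is_almost_hom f -> ~ has_bounded_range f ->
  exists D : int, forall p, exists n, `|f n - p| <= D.
Proof.
move=> [C hC] /unbounded_exists /(_ (C * 5))[m0 hm0].
have C0 : 0 < C by have := hC 0 0; lia.
have hN m := almost_hom_atN m hC.
have [m hm] : exists m, C * 3 <= f m.
  have [?|?] := leP 0 (f m0); first by exists m0; lia.
  by exists (- m0); have := hN m0; lia.
pose D := f m + C * 5; exists D => p.
suff H (k : nat) n : `|f n - p| <= k%:Z -> exists n, `|f n - p| <= D.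
  by apply: (H `|f 0 - p|%N 0); move: (f 0) => x; lia.
elim: k n => [|k IHk] n hk; first by exists n; rewrite /D; lia.
have [?|far] := leP `|f n - p| D; first by exists n.
have := hC n m; have := hC n (- m); have := hN m.
rewrite /hom_defect => h1 h2 h3.
have [lo|hi] := leP (f n) p.
  by apply: (IHk (n + m)); rewrite /D in far; lia.
by apply: (IHk (n - m)); rewrite /D in far; lia.
Qed.

Lemma almost_hom_inv f : is_almost_hom f -> ~ has_bounded_range f ->
  exists2 g, is_almost_hom g & has_bounded_range ((f \o g) - id).
Proof.
move=> hf nf; have [D /choice[g hg]] := almost_hom_almost_onto hf nf.
exists g; last by exists (D + 1) => p; have := hg p; rewrite !fctE /=; lia.
have [C hC] := hf.
have gN (x y : int) : `|f (x - y) - f x + f y| < C.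
  by have := hC (x - y) y; rewrite /hom_defect subrK; lia.
have [L hL] := almost_hom_proper (D * 3 + C * 2) hf nf.
exists (L + 1) => p q; rewrite /hom_defect.
suff : `|g (p + q) - g p - g q| <= L by lia.
apply: hL; move: (hg p) (hg q) (hg (p + q)).
by move: (gN (g (p + q)) (g p)) (gN (g (p + q) - g p) (g q)); lia.
Qed.

Definition almost_hom_pred : pred (int -> int) :=
  [pred f | `[< is_almost_hom f >]].

Fact almost_hom_zmod_closed : zmod_closed almost_hom_pred.
Proof.
split=> [|f g /asboolP hf /asboolP hg]; apply/asboolP.
  by apply: almost_hom_bounded; exists 1 => p.
exact: almost_hom_add hf (almost_hom_opp hg).
Qed.

HB.instance Definition _ :=
  GRing.isZmodClosed.Build (int -> int) almost_hom_pred almost_hom_zmod_closed.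

(* The group operations on almostHom are the pointwise ones of int -> int. *)
Record almostHom := AlmostHom {
  almostHom_fun :> int -> int;
  almostHom_funP : almostHom_fun \in almost_hom_pred
}.

HB.instance Definition _ := [isSub for almostHom_fun].
HB.instance Definition _ := [Choice of almostHom by <:].
HB.instance Definition _ := [SubChoice_isSubZmodule of almostHom by <:].

Lemma almostHomP (f : almostHom) : is_almost_hom f.
Proof. exact/asboolP/(almostHom_funP f). Qed.

Definition almostHom_of (f : int -> int) (hf : is_almost_hom f) : almostHom :=
  AlmostHom (asboolT hf).

Definition almostHom_id : almostHom := almostHom_of almost_hom_id.

Definition almostHom_comp (f g : almostHom) : almostHom :=
  almostHom_of (almost_hom_comp (almostHomP f) (almostHomP g)).

(* Every function with bounded range is an almost homomorphism
   (almost_hom_bounded), so boundedFun, taken here inside almostHom, is the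
   group of all of them. *)
Definition boundedFun : pred almostHom :=
  [pred f : almostHom | `[< has_bounded_range f >]].

Fact boundedFun_zmod_closed : zmod_closed boundedFun.
Proof.
split=> [|f g /asboolP[C hC] /asboolP[D hD]]; apply/asboolP.
  by exists 1 => p.
exists (C + D) => p; have := hC p; have := hD p.
by rewrite /= !fctE; lia.
Qed.

HB.instance Definition _ := GRing.isZmodClosed.Build almostHom boundedFun
  boundedFun_zmod_closed.

Definition eudoxus : Type :=
  Quotient.quot (GRing.ZmodClosed.clone almostHom boundedFun _).
HB.instance Definition _ := GRing.Zmodule.on eudoxus.
HB.instance Definition _ := EqQuotient.on eudoxus.

Definition cls (f : almostHom) : eudoxus := (\pi_eudoxus f)%qT.

Lemma clsP (f g : almostHom) :
  cls f = cls g <-> has_bounded_range ((f : int -> int) - g).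
Proof.
split=> [/eqP|h]; last apply/eqP.
  by rewrite /cls -Quotient.idealrBE => /asboolP.
by rewrite /cls -Quotient.idealrBE; apply/asboolP.
Qed.

Lemma cls_surj (x : eudoxus) : exists f, x = cls f.
Proof. by exists (repr x); rewrite /cls reprK. Qed.

Lemma clsD (f g : almostHom) : cls (f + g) = cls f + cls g.
Proof. exact: Quotient.pi_add. Qed.

Lemma cls0 : cls 0 = 0.
Proof. by rewrite /cls (@pi_zeror _ _ _ _ _ eudoxus). Qed.

Definition eudoxus_one : eudoxus := cls almostHom_id.

(* Composition of chosen representatives; cls_comp shows that the product does
   not depend on the choice. *)
Definition eudoxus_mul (x y : eudoxus) : eudoxus :=
  cls (almostHom_comp (repr x) (repr y)).

Lemma cls_comp (f g : almostHom) :
  eudoxus_mul (cls f) (cls g) = cls (almostHom_comp f g).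
Proof.
rewrite /eudoxus_mul; set f' := repr _; set g' := repr _.
have /clsP hf : cls f' = cls f by rewrite /cls reprK.
have /clsP hg : cls g' = cls g by rewrite /cls reprK.
transitivity (cls (almostHom_comp f' g)); apply/clsP.
  exact: comp_bounded_r (almostHomP f') hg.
exact: comp_bounded_l hf.
Qed.

Lemma bounded_eq (f g : int -> int) : f =1 g -> has_bounded_range (f - g).
Proof. by move=> fg; exists 1 => p; rewrite !fctE fg subrr. Qed.

Fact eudoxus_mulA : associative eudoxus_mul.
Proof.
move=> x y z; have [f ->] := cls_surj x; have [g ->] := cls_surj y.
have [h ->] := cls_surj z; rewrite !cls_comp.
by apply/clsP/bounded_eq.
Qed.

Fact eudoxus_mulC : commutative eudoxus_mul.
Proof.
move=> x y; have [f ->] := cls_surj x; have [g ->] := cls_surj y.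
rewrite !cls_comp; apply/clsP.
exact: comp_commute (almostHomP f) (almostHomP g).
Qed.

Fact eudoxus_mul1 : left_id eudoxus_one eudoxus_mul.
Proof.
by move=> x; have [f ->] := cls_surj x; rewrite cls_comp; apply/clsP/bounded_eq.
Qed.

Fact eudoxus_mulDl : left_distributive eudoxus_mul +%R.
Proof.
move=> x y z; have [f ->] := cls_surj x; have [g ->] := cls_surj y.
have [h ->] := cls_surj z; rewrite -clsD !cls_comp -clsD.
by apply/clsP/bounded_eq.
Qed.

Lemma cls_eq0 (f : almostHom) : cls f = 0 <-> has_bounded_range f.
Proof.
rewrite -cls0; split=> [/clsP[C hC]|[C hC]].
  by exists C => p; have := hC p; rewrite /= ?fctE subr0.
by apply/clsP; exists C => p; rewrite /= ?fctE subr0.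
Qed.

Fact eudoxus_one_neq0 : eudoxus_one != 0.
Proof.
by apply/eqP => /cls_eq0[C hC]; have := hC C; have := hC (- C); rewrite /=; lia.
Qed.

HB.instance Definition _ := GRing.Zmodule_isComNzRing.Build eudoxus
  eudoxus_mulA eudoxus_mulC eudoxus_mul1 eudoxus_mulDl eudoxus_one_neq0.

Lemma clsM (f g : almostHom) : cls f * cls g = cls (almostHom_comp f g).
Proof. exact: cls_comp. Qed.

Lemma cls1 : cls almostHom_id = 1.
Proof. by []. Qed.

Fact eudoxus_inv_ex (x : eudoxus) : exists y : eudoxus, x != 0 -> y * x = 1.
Proof.
have [->|] := eqVneq x 0; first by exists 0.
have [f ->] := cls_surj x => /eqP f0.
have [|g hg hfg] := almost_hom_inv (almostHomP f); first by move/cls_eq0.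
exists (cls (almostHom_of hg)) => _; rewrite mulrC clsM -cls1.
exact/clsP.
Qed.

Definition eudoxus_inv (x : eudoxus) : eudoxus :=
  if x == 0 then 0 else sval (cid (eudoxus_inv_ex x)).

Fact eudoxus_mulVf (x : eudoxus) : x != 0 -> eudoxus_inv x * x = 1.
Proof.
by move=> x0; rewrite /eudoxus_inv ifN //; case: cid => y /= /(_ x0).
Qed.

Fact eudoxus_inv0 : eudoxus_inv 0 = 0.
Proof. by rewrite /eudoxus_inv ifT. Qed.

HB.instance Definition _ := GRing.ComNzRing_isField.Build eudoxus
  eudoxus_mulVf eudoxus_inv0.

Definition infinitely_many_positive_values (f : int -> int) : Prop :=
  infinite_set ([set f m%:Z | m in [set: nat]] `&` [set v | 0 < v]).

Definition eudoxus_pos : set eudoxus :=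
  [set cls f | f in [set f : almostHom | infinitely_many_positive_values f]].

(* Main.v *)
From HB Require Import structures.
From mathcomp Require Import all_boot all_order all_algebra.
From mathcomp Require Import boolp classical_sets functions cardinality.
From mathcomp Require Import zify.
Require Import Defs.

(** Up to a bounded error, an almost homomorphism is linear: [m * f n] and
    [n * f m] are both close to [f (m * n)], hence to each other, with an error
    of order [m + n].  So once a single value [f n], with [n] a natural number,
    exceeds the defect bound, [f m] grows at least linearly in [m]
    ([almost_hom_diverges]).  Therefore, for an almost homomorphism [f], taking
    infinitely many positive values on the natural numbers is the same as
    tending to [+oo] there ([infinitely_many_positive_valuesP]), and this second
    condition is plainly stable under sums and under composition, the latter
    because the inner function ends up in the domain where the outer one is
    large.

    Bounded functions do not tend to [+oo], so 0 is not positive.  If neither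
    [f] nor [- f] tends to [+oo], then [f] is bounded on the natural numbers,
    and then everywhere since [f (- m)] is close to [- f m]; so the class of [f]
    is 0 ([almost_hom_trichotomy]). *)

Set Implicit Arguments.
Unset Strict Implicit.
Unset Printing Implicit Defensive.

Import Order.TTheory GRing.Theory Num.Theory.
Local Open Scope classical_set_scope.
Local Open Scope ring_scope.

Definition diverges_to_pinfty (f : int -> int) : Prop :=
  forall K : int, exists N : nat, forall m : nat, (N <= m)%N -> K < f m%:Z.

Lemma finite_int_ubounded (A : set int) :
  finite_set A -> exists K : int, forall v, A v -> v <= K.
Proof.
move=> /finite_seqP[s ->]; elim: s => [|v s [K hK]]; first by exists 0.
exists (`|v| + `|K|) => w /=; rewrite in_cons => /orP[/eqP ->|/hK]; lia.
Qed.

Lemma ubounded_pos_finite (A : set int) (K : int) :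
  (forall v, A v -> v <= K) -> finite_set (A `&` [set v | 0 < v]).
Proof.
move=> hK; apply: (@sub_finite_set _ _ (Posz @` `I_(`|K|%N.+1))).
  by move=> v [/hK vK /= v0]; exists `|v|%N => /=; lia.
exact/finite_image/finite_II.
Qed.

Lemma infinitely_many_positive_values_unbounded f :
  infinitely_many_positive_values f ->
  forall K : int, exists m : nat, K < f m%:Z.
Proof.
move=> inf K; apply: contrapT => nex; apply: inf.
apply: (@ubounded_pos_finite _ K) => _ [m _ <-].
by rewrite leNgt; apply/negP => Km; apply: nex; exists m.
Qed.

(** With [C] a strict bound on the defect and [f n > C], comparing both [m * f n]
    and [n * f m] with [f (m * n)] gives [n * f m >= m * (f n - C) - (n + 2) * C],
    which is at least [m - (n + 2) * C]; dividing by [n] yields linear growth. *)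
Lemma almost_hom_diverges f :
  is_almost_hom f -> (forall K : int, exists m : nat, K < f m%:Z) ->
  diverges_to_pinfty f.
Proof.
move=> [C hC] unb K.
have [n hn] := unb C; have f0C := almost_hom_at0 hC.
(* [f 0] is below the defect bound, hence [n] is positive and can be cancelled. *)
have n0 : 0 < n%:Z by case: n hn => // hn; have : C < f 0 := hn; lia.
exists (absz ((n%:Z + 2) * C + n%:Z * K)).+1 => m hm.
have h1 := almost_hom_mul_nat hC m n%:Z.
have h2 := almost_hom_mul_nat hC n m%:Z.
rewrite (mulrC n%:Z m%:Z) in h2.
have h3 : m%:Z * (C + 1) <= m%:Z * f n%:Z by rewrite ler_wpM2l //; lia.
rewrite -(ltr_pM2l n0).
move: h1 h2 h3 hm; move: (f (m%:Z * n%:Z)) (m%:Z * f n%:Z) (n%:Z * f m%:Z).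
by move: (n%:Z * K) => a b c d; lia.
Qed.

Lemma infinitely_many_positive_valuesP f : is_almost_hom f ->
  infinitely_many_positive_values f <-> diverges_to_pinfty f.
Proof.
move=> hf; split.
  by move/infinitely_many_positive_values_unbounded; apply: almost_hom_diverges.
move=> div /finite_int_ubounded[K hK].
have [N /(_ N (leqnn N)) fN] := div `|K|.
by have := hK (f N%:Z) (conj (imageP _ I) _); rewrite /=; lia.
Qed.

Lemma eudoxus_posP x : eudoxus_pos x <->
  exists2 f : almostHom, diverges_to_pinfty f & x = cls f.
Proof.
split=> [[f /= hf <-]|[f hf ->]]; exists f => //.
  exact/(infinitely_many_positive_valuesP (almostHomP f)).
exact/(infinitely_many_positive_valuesP (almostHomP f)).
Qed.

Lemma bounded_not_diverges f : has_bounded_range f -> ~ diverges_to_pinfty f.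
Proof.
by move=> [C hC] /(_ C)[N /(_ N (leqnn N))]; have := hC N%:Z; lia.
Qed.

Lemma divergesD f g : diverges_to_pinfty f -> diverges_to_pinfty g ->
  diverges_to_pinfty (f + g).
Proof.
move=> hf hg K; have [M hM] := hf `|K|; have [N hN] := hg 0.
exists (maxn M N) => m; rewrite geq_max => /andP[/hM fm /hN gm].
by rewrite fctE; lia.
Qed.

Lemma diverges_comp f g : diverges_to_pinfty f -> diverges_to_pinfty g ->
  diverges_to_pinfty (f \o g).
Proof.
move=> hf hg K; have [M hM] := hf K; have [N hN] := hg M%:Z.
exists N => m /hN gm /=; have -> : g m%:Z = `|g m%:Z|%N%:Z by lia.
by apply: hM; lia.
Qed.

Lemma diverges_id : diverges_to_pinfty id.
Proof. by move=> K; exists `|K|%N.+1 => m; lia. Qed.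

Lemma almost_hom_trichotomy f : is_almost_hom f ->
  [\/ has_bounded_range f, diverges_to_pinfty f | diverges_to_pinfty (- f)].
Proof.
move=> hf.
have [ub|/existsNP[K hK]] := pselect (forall K : int, exists m : nat, K < f m%:Z).
  by apply: Or32; apply: almost_hom_diverges.
have [lb|/existsNP[L hL]] :=
    pselect (forall K : int, exists m : nat, K < (- f) m%:Z).
  by apply: Or33; apply: almost_hom_diverges => //; apply: almost_hom_opp.
apply: Or31; have [C hC] := hf.
have bnd (m : nat) : `|f m%:Z| <= `|K| + `|L|.
  have : ~~ (K < f m%:Z) by apply/negP => h; apply: hK; exists m.
  have : ~~ (L < (- f) m%:Z) by apply/negP => h; apply: hL; exists m.
  by rewrite fctE; lia.
exists (`|K| + `|L| + C * 2 + 1) => p.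
have hN := almost_hom_atN p hC; have := bnd `|p|%N.
have [p0|p0] := leP 0 p.
  by rewrite (_ : `|p|%N%:Z = p); lia.
by rewrite (_ : `|p|%N%:Z = - p); lia.
Qed.

Theorem theorem13 : is_ordered_field eudoxus_pos.
Proof.
split; first split.
- move=> /eudoxus_posP[f hf /esym/cls_eq0 fB].
  exact: bounded_not_diverges fB hf.
- move=> _ _ /eudoxus_posP[f hf ->] /eudoxus_posP[g hg ->].
  apply/eudoxus_posP; exists (f + g); last by rewrite clsD.
  exact: divergesD.
- move=> x; have [f ->] := cls_surj x => f0.
  have [/cls_eq0 //|fp|fn] := almost_hom_trichotomy (almostHomP f).
    by left; apply/eudoxus_posP; exists f.
  right; apply/eudoxus_posP; exists (- f) => //.
  by apply/eqP; rewrite eq_sym -addr_eq0 -clsD addNr cls0.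
- rewrite -cls1; apply/eudoxus_posP; exists almostHom_id => //.
  exact: diverges_id.
- move=> _ _ /eudoxus_posP[f hf ->] /eudoxus_posP[g hg ->].
  apply/eudoxus_posP; exists (almostHom_comp f g); last by rewrite clsM.
  exact: diverges_comp.
Qed.
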